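(* Let $n\ge 1$ be an integer and let $X$ be an $S(n)$-space. Then $X$ is $S(n)$-closed if and only if every infinite set $A\subseteq X$ weakly $\theta(n)$-converges to the set $B$ of all its $\theta(n)$-complete accumulation points.
   Context: All neighborhoods are open; $\overline{M}=\mathrm{cl}\,M$ is the closure and $\mathrm{Int}\,M$ the interior in the space $X$. $\theta^n$-closure: $\mathrm{cl}_{\theta^0}M=\mathrm{cl}\,M$; for $n\ge 1$, $x\notin \mathrm{cl}_{\theta^n}M$ iff there are open neighborhoods $U_1,\dots,U_n$ of $x$ with $\mathrm{cl}\,U_i\subseteq U_{i+1}$ for $i=1,\dots,n-1$ and $\mathrm{cl}\,U_n\cap M=\emptyset$. The $\theta^n$-interior is $\mathrm{Int}_{\theta^n}M=X\setminus \mathrm{cl}_{\theta^n}(X\setminus M)$. For $n\ge1$, $X$ is an $S(n)$-space if $x\notin\mathrm{cl}_{\theta^n}\{y\}$ for any two distinct points $x,y\in X$. An $S(n)$-space is $S(n)$-closed if it is closed in every $S(n)$-space containing it as a subspace. An $n$-hull of a point $x$ is a neighborhood $U$ of $x$ for which there are neighborhoods $U_1,\dots,U_n=U$ of $x$ with $\mathrm{cl}\,U_i\subseteq U_{i+1}$ for $i=1,\dots,n-1$. A point $x$ is a $\theta(n)$-complete accumulation point of an infinite set $F$ if $|F\cap\overline U|=|F|$ for every $n$-hull $U$ of $x$. For $k\ge 0$, an $S(k)$-cover of a subset $B\subseteq X$ is a family $\{U_\alpha\}$ of open subsets of $X$ such that $B\subseteq\bigcup_\alpha \mathrm{Int}_{\theta^k}U_\alpha$.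 A set $A$ weakly $\theta(n)$-converges to a set $B$ if for every $S(n-1)$-cover $\gamma$ of $B$ there is a finite family $\{U_{\alpha_i}\}_{i=1}^k\subseteq\gamma$ such that $|A\setminus \mathrm{Int}(\bigcup_{i=1}^k\overline{U_{\alpha_i}})|<|A|$. *)

(* Defs.v *)
From mathcomp Require Import all_boot.
From mathcomp Require Import boolp classical_sets functions cardinality topology.

Set Implicit Arguments.
Unset Strict Implicit.
Unset Printing Implicit Defensive.

Local Open Scope classical_set_scope.
Local Open Scope card_scope.

Definition card_lt (T U : Type) (A : set T) (B : set U) : Prop :=
  A #<= B /\ ~ (A #= B).

(* Only the values U 1, ..., U n of the sequence U are constrained. *)
Definition theta_chain (X : topologicalType) (n : nat) (x : X)
    (U : nat -> set X) : Prop :=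
  (forall i, (1 <= i <= n)%N -> open_nbhs x (U i)) /\
  (forall i, (1 <= i < n)%N -> closure (U i) `<=` U i.+1).

Definition theta_closure (X : topologicalType) (n : nat) (M : set X) : set X :=
  if n is 0%N then closure M
  else [set x | ~ exists U : nat -> set X,
                    theta_chain n x U /\ closure (U n) `&` M = set0].

Definition theta_interior (X : topologicalType) (n : nat) (M : set X) : set X :=
  ~` theta_closure n (~` M).

(* Meant for n >= 1. *)
Definition S_space (n : nat) (X : topologicalType) : Prop :=
  forall x y : X, x <> y -> ~ theta_closure n [set y] x.

Definition topological_embedding (X Y : topologicalType) (f : X -> Y) : Prop :=
  injective f /\
  forall U : set X, open U <-> exists2 V : set Y, open V & f @^-1` V = U.

(* "X is a subspace of Y" is rendered by an embedding of X into Y. *)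
Definition S_closed (n : nat) (X : topologicalType) : Prop :=
  S_space n X /\
  forall (Y : topologicalType) (f : X -> Y),
    S_space n Y -> topological_embedding f -> closed (range f).

(* Meant for n >= 1. *)
Definition is_hull (X : topologicalType) (n : nat) (x : X) (V : set X) : Prop :=
  exists U : nat -> set X, theta_chain n x U /\ U n = V.

Definition complete_accumulation_points (X : topologicalType) (n : nat)
    (F : set X) : set X :=
  [set x | forall V : set X, is_hull n x V -> (F `&` closure V) #= F].

Definition S_cover (X : topologicalType) (k : nat) (B : set X)
    (gamma : set (set X)) : Prop :=
  (forall U, gamma U -> open U) /\
  B `<=` \bigcup_(U in gamma) theta_interior k U.

(* Meant for n >= 1, so that n.-1 is the genuine n - 1. *)
Definition weakly_theta_converges (X : topologicalType) (n : nat)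
    (A B : set X) : Prop :=
  forall gamma : set (set X), S_cover n.-1 B gamma ->
    exists D : set (set X), [/\ finite_set D, D `<=` gamma &
      card_lt (A `\` interior (\bigcup_(U in D) closure U)) A].

(* Main.v *)
(* An S(n)-space X is S(n)-closed iff every S(n-1)-cover of X has a finite
   subfamily with dense union: from a cover without one, the complements of the
   closures of its finite unions generate a filter, and adding a point whose
   neighborhoods trace this filter yields an S(n)-space in which X is not
   closed.
   If X is S(n)-closed, complete an S(n-1)-cover of B by n-hulls V with
   |A `&` closure V| < |A| and take a finite subfamily with dense union.
   Conversely, given a cover without such a subfamily, let A be of minimal
   cardinality among the complements of the closures of its finite unions: then
   |A `\` closure U| = |A| for every finite union U, so the cover itself
   witnesses that A does not weakly converge. *)
Require Import Defs.
From HB Require Import structures.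
From mathcomp Require Import all_boot.
From mathcomp Require Import boolp classical_sets functions cardinality topology.

Set Implicit Arguments.
Unset Strict Implicit.
Unset Printing Implicit Defensive.

Local Open Scope classical_set_scope.
Local Open Scope card_scope.

(** * Cardinal arithmetic from Zorn's lemma *)

(** Used below for maximal families of functions; the diagonal case lets [R] also impose conditions
    on single members. *)
Lemma maximal_pairwise (T : Type) (R : T -> T -> Prop) :
  exists S : set T, (forall x y, S x -> S y -> R x y) /\
    forall z, R z z -> (forall x, S x -> R x z /\ R z x) -> S z.
Proof.
pose P (S : set T) := forall x y, S x -> S y -> R x y.
have [F FP Ftot|S [PS maxS]] := @Zorn_bigcup T P.
  move=> x y [A FA Ax] [B FB By].
  by have [/(_ _ Ax)|/(_ _ By)] := Ftot A B FA FB; [move=> Bx|move=> Ay];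
    [exact: FP FB _ _ Bx By|exact: FP FA _ _ Ax Ay].
exists S; split=> // z Rzz Rz; apply: contrapT => nSz.
apply: (maxS (S `|` [set z])).
  by split=> [x|/(_ z (or_intror erefl))//]; left.
move=> x y [Sx|->] [Sy|->] //; first exact: PS.
  exact: (Rz _ Sx).1.
exact: (Rz _ Sy).2.
Qed.

Lemma card_le_inj (T U : Type) (A : set T) (B : set U) (f : T -> U) :
  set_fun A B f -> set_inj A f -> A #<= B.
Proof.
move=> fAB finj.
have /injfunPex[g] : exists2 f : T -> U, set_fun A B f & set_inj A f by exists f.
exact: inj_card_le g.
Qed.

Lemma card_le_ex (T : Type) (U : Type) (u : U) (A : set T) (B : set U) :
  A #<= B -> exists2 f : T -> U, set_fun A B f & set_inj A f.
Proof.
(* The point [u] rules out an empty codomain, so the injection extends to all of [T]. *)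
elim/Ppointed: U u B => [U u B|U _ B].
  by have : [set u] u by []; rewrite emptyE.
by move=> /pcard_leP/injfunPex.
Qed.

(* Hönig's argument: a maximal set [S] of choice functions that are pairwise
   distinct at every index must exhaust some [F i]; the resulting surjection
   [S -> F i] makes [F i] the smallest of the sets. *)
Lemma card_le_min (I T : Type) (i0 : I) (F : I -> set T) :
  exists i, forall j, F i #<= F j.
Proof.
pose R (f g : I -> T) :=
  (forall i, F i (f i)) /\ forall i, f i = g i -> f = g.
have [S [RS maxS]] := maximal_pairwise R.
have [[i Si]|nS] := pselect (exists i, F i `<=` [set f i | f in S]).
  exists i => j.
  have [F0|/set0P[x0 Fx0]] := eqVneq (F i) set0; first by rewrite F0 card_ge0.
  have [f0 Sf0 _] := Si _ Fx0.
  have /choice[c cP] : forall x, exists f, F i x -> S f /\ f i = x.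
    move=> x; have [Fx|nFx] := pselect (F i x); last by exists f0.
    by have [f Sf fx] := Si _ Fx; exists f.
  apply: (@card_le_inj _ _ _ _ (fun x => c x j)) => [x Fx|x y].
    by have [/(RS _ _)/(_ Sf0)[]] := cP _ Fx.
  rewrite !inE => Fx Fy; have [Sx cx] := cP _ Fx; have [Sy cy] := cP _ Fy.
  by move=> e; rewrite -cx -cy ((RS _ _ Sx Sy).2 j e).
(* If no [F i] is exhausted, a choice [g] of missed values belongs to [S] by maximality, a
   contradiction at [i0]. *)
have /choice[g gP] : forall i, exists x, F i x /\ forall f, S f -> f i <> x.
  move=> i; apply: contrapT => nx; apply: nS; exists i => x Fx.
  apply: contrapT => nSx; apply: nx; exists x; split=> // f Sf fx.
  by apply: nSx; exists f.
have Sg : S g.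
  apply: maxS => [|f Sf]; first by split=> // i; exact: (gP i).1.
  split; split=> [i|i e]; [exact: (RS _ _ Sf Sf).1| |exact: (gP i).1|].
    by case: ((gP i).2 _ Sf).
  by case: ((gP i).2 _ Sf).
by case: ((gP i0).2 _ Sg).
Qed.

Lemma card_le_total (T : Type) (A B : set T) : A #<= B \/ B #<= A.
Proof.
have [[] /(_ _)h] := card_le_min true (fun b : bool => if b then A else B).
  by left; exact: (h false).
by right; exact: (h true).
Qed.

(* A maximal family [S] of disjoint injective sequences in [A] misses only
   finitely many points, so [A] embeds into [S * nat], and so does [A * bool]. *)
Lemma infinite_set_double (T : Type) (A : set T) : infinite_set A ->
  exists g : T -> bool -> T, (forall x b, A x -> A (g x b)) /\
    forall x y b c, A x -> A y -> g x b = g y c -> x = y /\ b = c.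
Proof.
move=> Ainf.
pose R (s t : nat -> T) :=
  (forall i, A (s i)) /\ forall i j, s i = t j -> s = t /\ i = j.
have [S [RS maxS]] := maximal_pairwise R.
pose E := [set x | exists s i, S s /\ s i = x].
have finAE : finite_set (A `\` E).
  apply: contrapT => inf.
  have [x0 _] := infinite_setN0 inf.
  have /(card_le_ex x0)[u uAE uinj] := (infiniteP _).1 inf.
  have uA i : (A `\` E) (u i) by exact: uAE.
  have Su : S u.
    apply: maxS => [|s Ss].
      split=> [i|i j e]; first exact: (uA i).1.
      by split=> //; apply: uinj; rewrite ?inE.
    have nE i j : s i <> u j by move=> e; apply: (uA j).2; exists s, i.
    split; split=> [i|i j e]; [exact: (RS _ _ Ss Ss).1| |exact: (uA i).1|].
      by case: (nE i j).
    by case: (nE j i).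
  by apply: (uA 0).2; exists u, 0.
have [s0 Ss0] : exists s, S s.
  apply: contrapT => nS; apply: Ainf; apply: sub_finite_set finAE => x Ax.
  by split=> // -[s [i [Ss _]]]; apply: nS; exists s.
have /(card_le_ex 0)[k _ kinj] := finite_set_countable finAE.
(* A point [s i] is coded by [s] and [2i], a leftover point [x] by [s0] and [2 k(x) + 1]; parity
   keeps the two kinds apart. *)
have /choice[c cP] : forall x, exists p : (nat -> T) * nat, A x -> S p.1 /\
    ((exists2 i, p.2 = i.*2 & p.1 i = x) \/ (~ E x /\ p = (s0, (k x).*2.+1))).
  move=> x; have [[s [i [Ss six]]]|nEx] := pselect (E x).
    by exists (s, i.*2) => _; split=> //; left; exists i.
  by exists (s0, (k x).*2.+1) => _; split=> //; right.
have cinj x y : A x -> A y -> c x = c y -> x = y.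
  move=> Ax Ay exy; have [_ cx] := cP x Ax; have [_ cy] := cP y Ay.
  move: cx cy; rewrite exy; move=> [[i ei ix]|[nx ei]] [[j ej jy]|[ny ej]].
  - have eij : i = j by apply: double_inj; rewrite -ei -ej.
    by rewrite -ix eij.
  - by move: ei; rewrite ej /= => /(congr1 odd); rewrite /= !odd_double.
  - by move: ej; rewrite ei /= => /(congr1 odd); rewrite /= !odd_double.
  - move: ej; rewrite ei => -[/double_inj exy']; apply: kinj exy'; exact: mem_set.
(* Index [j] is split into [2j] and [2j + 1], one for each value of [b]. *)
exists (fun x b => (c x).1 (b + (c x).2.*2)); split=> [x b Ax|x y b d Ax Ay].
  by have [Sc _] := cP _ Ax; exact: (RS _ _ Sc Sc).1.
have [Sx _] := cP x Ax; have [Sy _] := cP y Ay.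
move=> e; have [e1 {}e] := (RS _ _ Sx Sy).2 _ _ e.
have ebd : b = d.
  by have := congr1 odd e; rewrite !oddD !odd_double !addbF !oddb.
split=> //; apply: cinj => //; move: e1 e; rewrite ebd.
case: (c x) => s i; case: (c y) => t j /= -> /addnI /double_inj -> //.
Qed.

(** Doubling gives two disjoint copies of [B] inside [B]: one receives [B], the other the points of
    [A] outside [B]. *)
Lemma card_le_setU (T : Type) (A B : set T) :
  infinite_set B -> A #<= B -> A `|` B #<= B.
Proof.
move=> Binf; have [b _] := infinite_setN0 Binf.
move=> /(card_le_ex b)[f fAB finj]; have [g [gB ginj]] := infinite_set_double Binf.
apply: (@card_le_inj _ _ _ _ (fun x =>
  if pselect (B x) then g x true else g (f x) false)).
  by move=> x ABx; case: pselect => [Bx|nBx]; apply: gB => //; apply: fAB; case: ABx.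
move=> x y; rewrite !inE => ABx ABy.
have fB z : (A `|` B) z -> ~ B z -> A z by case.
case: pselect => [Bx|nBx]; case: pselect => [By|nBy].
- by move=> /ginj[].
- by move=> /ginj[//||//]; apply: fAB; exact: fB.
- by move=> /ginj[||//]; first (by apply: fAB; exact: fB).
- have Ax := fB _ ABx nBx; have Ay := fB _ ABy nBy.
  by move=> /ginj[||e _]; [exact: fAB|exact: fAB|apply: finj e; exact: mem_set].
Qed.

Lemma card_le_lt_trans (T U V : Type) (A : set T) (B : set U) (C : set V) :
  A #<= B -> card_lt B C -> card_lt A C.
Proof.
move=> AB [BltC BneC]; split; first exact: card_le_trans BltC.
by move=> AltC; apply: BneC; apply: Cantor_Bernstein => //; rewrite -(card_le_eql AltC).
Qed.

Lemma finite_card_lt (T U : Type) (A : set T) (B : set U) :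
  finite_set A -> infinite_set B -> card_lt A B.
Proof.
move=> Afin Binf; split; last by move=> /eq_finite_set AB; apply: Binf; rewrite -AB.
exact: card_le_trans (finite_set_countable Afin) ((infiniteP _).1 Binf).
Qed.

(** By comparability let [A #<= B]. An infinite [B] absorbs [A]; a finite [B] makes the union
    finite. *)
Lemma card_lt_setU (T U : Type) (A B : set T) (C : set U) : infinite_set C ->
  card_lt A C -> card_lt B C -> card_lt (A `|` B) C.
Proof.
move=> Cinf AltC BltC.
wlog AB : A B AltC BltC / A #<= B.
  move=> h; have [|] := card_le_total A B; first exact: h.
  by rewrite setUC; apply: h.
have [Bfin|Binf] := pselect (finite_set B).
  apply: finite_card_lt => //; rewrite finite_setU; split=> //.
  exact: card_le_finite AB Bfin.
exact: card_le_lt_trans (card_le_setU Binf AB) BltC.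
Qed.

Lemma card_lt_bigcup (I T U : Type) (D : set I) (F : I -> set T) (C : set U) :
  infinite_set C -> finite_set D -> (forall i, D i -> card_lt (F i) C) ->
  card_lt (\bigcup_(i in D) F i) C.
Proof.
move=> Cinf [n]; elim: n D => [|n IH] D.
  rewrite II0 card_eq0 => /eqP -> _.
  by rewrite bigcup_set0; apply: finite_card_lt.
move=> /eq_cardSP[i Di Dn] DC; rewrite (bigcup_setD1 i) //.
by apply: card_lt_setU => //; [exact: DC|apply: IH Dn _ => j [/DC]].
Qed.

(** Iterating the injection from [a] never returns to [a], so by injectivity all iterates are
    distinct. *)
Lemma card_le_setD1_infinite (T : Type) (A : set T) (a : T) :
  A a -> A #<= A `\ a -> infinite_set A.
Proof.
move=> Aa /(card_le_ex a)[f fA finj].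
pose u i := iter i f a.
have Au i : A (u i) by elim: i => [|i IH] //=; exact: (fA _ IH).1.
apply/infiniteP/(@card_le_inj _ _ _ _ u) => [i _|i j _ _]; first exact: Au.
have nu k : a <> u k.+1 by move=> e; apply: (fA _ (Au k)).2.
elim: i j => [|i IH] [|j] //= e; [by case: (nu j)|by case: (nu i)|].
by congr S; apply: IH; apply: finj e; exact: mem_set.
Qed.

(** * Chains of neighborhoods, hulls and separation of points *)

Lemma theta_chain_subset (X : topologicalType) (n : nat) (x : X)
    (U : nat -> set X) (i j : nat) :
  theta_chain n x U -> (1 <= i)%N -> (i <= j <= n)%N -> U i `<=` U j.
Proof.
move=> [_ Uc] i1; elim: j => [|j IH] /andP[ij jn].
  by move: i1; rewrite leqNgt ltnS ij.
move: ij; rewrite leq_eqVlt => /predU1P[->//|ij].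
apply: (@subset_trans _ (U j)); first by apply: IH; rewrite -ltnS ij ltnW.
apply: subset_trans (@subset_closure _ _) (Uc _ _).
by rewrite jn (leq_trans i1).
Qed.

Lemma theta_chain_intersection (X : topologicalType) (n : nat) (x : X)
    (U V : nat -> set X) :
  theta_chain n x U -> theta_chain n x V ->
  theta_chain n x (fun i => U i `&` V i).
Proof.
move=> [Un Uc] [Vn Vc]; split=> i hi.
  by apply: open_nbhsI; [exact: Un|exact: Vn].
by move=> y /closureI[/(Uc _ hi) ? /(Vc _ hi)].
Qed.

Lemma theta_chain_preimage (X Y : topologicalType) (f : X -> Y) (n : nat)
    (x : X) (U : nat -> set Y) :
  continuous f -> theta_chain n (f x) U ->
  theta_chain n x (fun i => f @^-1` U i).
Proof.
move=> /[dup] fc /continuousP fo [Un Uc]; split=> i hi.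
  by have [Uo Ux] := Un _ hi; split=> //; exact: fo.
apply: subset_trans (preimage_subset (Uc _ hi)).
rewrite [X in X `<=` _]closureE; apply: smallest_sub.
  by move/continuous_closedP: fc; apply; exact: closed_closure.
by apply: preimage_subset; exact: subset_closure.
Qed.

(** For positive [n], a chain witnessing the interior has its last closure inside [V], so [V] can be
    appended to it. This turns covers into families of hulls. *)
Lemma theta_interior_hull (X : topologicalType) (n : nat) (V : set X) (x : X) :
  open V -> theta_interior n V x <-> is_hull n.+1 x V.
Proof.
move=> Vo; rewrite /theta_interior /theta_closure.
case: n => [|n].
  rewrite closure_setC setCK; split=> [Vx|[U [[Un _]] <-]].
    exists (fun=> V); split=> //; split=> [i _|i].
      by split=> //; exact: interior_subset Vx.
    by rewrite ltnS; case: i.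
  exact: open_nbhs_nbhs (Un 1 isT).
split=> [/contrapT[U [[Un Uc]]]|[U [[Un Uc] <-]]].
  rewrite -subsets_disjoint => UV.
  exists (fun i => if (i <= n.+1)%N then U i else V); rewrite ltnn; split=> //.
  have Vx : V x by apply/UV/subset_closure; exact: (Un n.+1 (leqnn _)).2.
  split=> i /andP[i1 ilt].
    by case: ifPn => [ile|_]; [apply: Un; rewrite i1|split].
  rewrite -ltnS ilt; move: ilt; rewrite ltnS leq_eqVlt => /predU1P[->|ilt].
    by rewrite ltnn.
  by rewrite ilt; apply: Uc; rewrite i1.
move=> nU; apply: nU; exists U; split; last first.
  by rewrite -subsets_disjoint; exact: (Uc n.+1 (ltnSn _)).
split=> i /andP[i1 ilt].
  by apply: Un; rewrite i1 ltnW.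
by apply: Uc; rewrite i1 ltnW.
Qed.

Lemma S_coverP (X : topologicalType) (n : nat) (B : set X)
    (gamma : set (set X)) :
  S_cover n B gamma <-> (forall U, gamma U -> open U) /\
    forall x, B x -> exists2 U, gamma U & is_hull n.+1 x U.
Proof.
split=> -[go gB]; split=> // x /gB[U gU Ux]; exists U => //.
  exact: (theta_interior_hull n x (go _ gU)).1.
exact: (theta_interior_hull n x (go _ gU)).2.
Qed.

Lemma theta_separatedP (X : topologicalType) (n : nat) (x y : X) :
  ~ theta_closure n.+1 [set y] x <->
  exists2 U, theta_chain n.+1 x U & ~ closure (U n.+1) y.
Proof.
rewrite /theta_closure; split=> [/contrapT[U [Uc Uy]]|[U Uc Uy]].
  by exists U => // Uny; have : set0 y by rewrite -Uy.
move=> nU; apply: nU; exists U; split=> //; apply/seteqP; split=> //.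
by move=> z [Uz zy]; apply: Uy; rewrite -zy.
Qed.

(* The complements of the closures of a chain, in reverse order, form a chain. *)
Lemma theta_separated_sym (X : topologicalType) (n : nat) (x y : X) :
  ~ theta_closure n.+1 [set y] x -> ~ theta_closure n.+1 [set x] y.
Proof.
move=> /theta_separatedP[U /[dup] Uchain [Un Uc] Uy]; apply/theta_separatedP.
(* An open [U i] is disjoint from the closure of the complement of its closure. *)
have clC (i : nat) : (1 <= i <= n.+1)%N -> closure (~` closure (U i)) `<=` ~` U i.
  move=> hi; rewrite closure_setC; apply: subsetC.
  by rewrite -open_subsetE; [exact: subset_closure|exact: (Un _ hi).1].
exists (fun i => ~` closure (U (n.+2 - i))).
  split=> i /andP[i1 ilt].
    split; first by apply: closed_openC; exact: closed_closure.
    move=> Uiy; apply: Uy; move: Uiy; apply: closureS.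
    apply: theta_chain_subset Uchain _ _; first by rewrite subn_gt0.
    by rewrite leqnn leq_subLR -addn1 addnC leq_add2r i1.
  have hi : (1 <= n.+2 - i <= n.+1)%N.
    by rewrite subn_gt0 ltnS (ltnW ilt) leq_subLR (leq_add2r n.+1 1 i).
  apply: subset_trans (clC _ hi) _; apply: subsetC.
  have -> : n.+2 - i = (n.+2 - i.+1).+1 by rewrite -subSn // ltnW.
  by apply: Uc; rewrite subn_gt0 ltnS ilt subSS ltn_subrL i1.
by rewrite subSnn => /(clC 1 isT); apply; exact: (Un 1 isT).2.
Qed.

Lemma closure_bigcup_finite (X : topologicalType) (D : set (set X)) :
  finite_set D -> closure (\bigcup_(U in D) U) = \bigcup_(U in D) closure U.
Proof.
move=> Dfin; apply/seteqP; split; last first.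
  by move=> x [U DU]; apply: closureS; exact: bigcup_sup.
rewrite [X in X `<=` _]closureE; apply: smallest_sub.
  by apply: closed_bigcup => // U _; exact: closed_closure.
by apply: subset_bigcup => U _; exact: subset_closure.
Qed.

(** * The one-point extension by a filter *)

(* [None] is a new point whose neighborhoods trace the filter [G] on [X]. *)
Definition point_extension (X : topologicalType) (G : filter_on X) : Type :=
  option X.

Section PointExtension.
Context {X : topologicalType} {G : filter_on X}.
Local Notation Y := (point_extension G).

Definition extension_some : X -> Y := Some.
Local Notation some := extension_some.

HB.instance Definition _ := Choice.on Y.

Let op : set_system Y :=
  [set V | open (some @^-1` V) /\ (V None -> filter G (some @^-1` V))].

Let opT : op setT.
Proof. by split=> [|_]; [exact: openT|exact: filterT]. Qed.

Let opI : setI_closed op.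
Proof.
move=> A B [Ao AG] [Bo BG]; split; first exact: openI.
by move=> [/AG GA /BG GB]; exact: filterI.
Qed.

Let op_bigU (I : Type) (f : I -> set Y) :
  (forall i, op (f i)) -> op (\bigcup_i f i).
Proof.
move=> fop; rewrite /op /= preimage_bigcup; split.
  by apply: bigcup_open => i _; exact: (fop i).1.
by move=> [i _ /((fop i).2)]; apply: filterS => x fx; exists i.
Qed.

HB.instance Definition _ := isOpenTopological.Build Y opT opI op_bigU.

Lemma open_point_extension (V : set Y) :
  open V = (open (some @^-1` V) /\ (V None -> filter G (some @^-1` V))).
Proof. by []. Qed.

Let preimage_image_some (U : set X) : some @^-1` (some @` U) = U.
Proof. by apply/seteqP; split=> [x [y Uy [<-]]|x Ux] //; exists x. Qed.

Lemma open_image_some (U : set X) : open U -> open (some @` U).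
Proof.
by move=> Uo; rewrite open_point_extension preimage_image_some; split=> // -[].
Qed.

Lemma some_embedding : topological_embedding some.
Proof.
split=> [x y []//|U]; split=> [Uo|[V]].
  by exists (some @` U); [exact: open_image_some|exact: preimage_image_some].
by rewrite open_point_extension => -[Vo _] <-.
Qed.

(** The hypothesis gives [None] a neighborhood missing the image, so the closure does not gain
    [None]. *)
Lemma closure_image_some (A : set X) :
  filter G (~` closure A) -> closure (some @` A) `<=` some @` closure A.
Proof.
move=> GA; rewrite closureE; apply: smallest_sub; last first.
  by apply: image_subset; exact: subset_closure.
have e : some @^-1` (~` (some @` closure A)) = ~` closure A.
  by rewrite -[in RHS](preimage_image_some (closure A)).
rewrite -openC open_point_extension e; split=> //.
by apply: closed_openC; exact: closed_closure.
Qed.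

Lemma theta_chain_some (n : nat) (x : X) (U : nat -> set X) :
  theta_chain n x U -> filter G (~` closure (U n)) ->
  theta_chain n (some x) (fun i => some @` U i).
Proof.
move=> /[dup] Uchain [Un Uc] GU; split=> i hi.
  by have [Uo Ux] := Un _ hi; split; [exact: open_image_some|exists x].
(* The complements of the closures grow down the chain, so the condition on the last set passes to
   every [U i]. *)
have GUi : filter G (~` closure (U i)); last first.
  by move=> y /(closure_image_some GUi); apply: image_subset; exact: Uc.
apply: filterS GU; apply: subsetC; apply: closureS.
by move: hi => /andP[i1 ilt]; apply: theta_chain_subset Uchain _ _; rewrite // leqnn ltnW.
Qed.

(** Intersecting a separating chain with the chain of a hull as in the hypothesis keeps its closures
    away from [None], so it survives in the extension. Separating [None] from a point of [X] follows
    by symmetry. *)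
Lemma S_space_point_extension (n : nat) : S_space n.+1 X ->
  (forall x : X, exists2 U, is_hull n.+1 x U & filter G (~` closure U)) ->
  S_space n.+1 Y.
Proof.
move=> XS hullG.
have sep (x : X) (y : Y) : some x <> y -> ~ theta_closure n.+1 [set y] (some x).
  move=> xy; have [_ [W [Wchain <-]] GW] := hullG x.
  have [V Vchain Vy] : exists2 V, theta_chain n.+1 x V &
      ~ (some @` closure (V n.+1)) y.
    (* Against [None] the chain of the hull itself serves. *)
    case: y xy => [y|] xy; last by exists W => // -[].
    have /theta_separatedP[V Vchain Vy] : ~ theta_closure n.+1 [set y] x.
      by apply: XS => exy; apply: xy; rewrite exy.
    by exists V => // -[z Vz [zy]]; apply: Vy; rewrite -zy.
  have GVW : filter G (~` closure (V n.+1 `&` W n.+1)).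
    by apply: filterS GW; apply: subsetC; apply: closureS; exact: subIsetr.
  apply/theta_separatedP; exists (fun i => some @` (V i `&` W i)).
    exact: theta_chain_some (theta_chain_intersection Vchain Wchain) GVW.
  move=> /(closure_image_some GVW); apply: contra_not Vy.
  by apply: image_subset; apply: closureS; exact: subIsetl.
move=> [x|] y xy; first exact: sep.
case: y xy => [y|//] _.
by apply: theta_separated_sym; exact: sep.
Qed.

(** A closed range makes [None] isolated, and the trace of its neighborhood [{None}] is empty. *)
Lemma closed_range_some : closed (range some) -> filter G set0.
Proof.
rewrite -openC open_point_extension => -[_].
have -> : some @^-1` (~` range some) = set0.
  by apply/seteqP; split=> // x nx; apply: nx; exists x.
by apply => -[].
Qed.

End PointExtension.

(** * Closedness and finite subfamilies with dense union *)

(** The filter [G] contains the empty set exactly when some finite union is dense; closedness of [X]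
    in the extension forces this. *)
Lemma S_closed_cover (X : topologicalType) (n : nat) (gamma : set (set X)) :
  S_closed n.+1 X -> S_cover n setT gamma ->
  exists D : set (set X),
    [/\ finite_set D, D `<=` gamma & closure (\bigcup_(U in D) U) = setT].
Proof.
move=> [XS Xclosed] /S_coverP[_ gcover].
pose G : set_system X := [set V | exists D : set (set X),
  [/\ finite_set D, D `<=` gamma & ~` closure (\bigcup_(U in D) U) `<=` V]].
have GF : Filter G.
  split; first by exists set0; split=> //; exact: finite_set0.
    move=> A B [D [Df Dg DA]] [E [Ef Eg EB]]; exists (D `|` E); split.
    - by rewrite finite_setU.
    - by move=> U [/Dg|/Eg].
    - by rewrite bigcup_setU closureU setCU; apply: setISS.
  by move=> A B AB [D [Df Dg DA]]; exists D; split=> //; exact: subset_trans AB.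
have /closed_range_some[D [Df Dg /subsetC D0]] :
    closed (range (@extension_some X (FilterType G GF))).
  apply: Xclosed; last exact: some_embedding.
  apply: S_space_point_extension => // x.
  have [//|U gU hU] := gcover x; exists U => //.
  exists [set U]; split; [exact: finite_set1|by move=> _ ->|by rewrite bigcup_set1].
exists D; split=> //; apply/seteqP; split=> // x _.
by move: (D0 x); rewrite setCK; apply.
Qed.

(** Let [y] be a limit of the range outside it. Preimages of chains separating range points from [y]
    give a cover; for a finite subfamily with dense union, the closures of the images have a closed
    union that contains the range but not [y]. *)
Lemma cover_S_closed (X : topologicalType) (n : nat) : S_space n.+1 X ->
  (forall gamma : set (set X), S_cover n setT gamma ->
    exists D : set (set X),
      [/\ finite_set D, D `<=` gamma & closure (\bigcup_(U in D) U) = setT]) ->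
  S_closed n.+1 X.
Proof.
move=> XS cov; split=> // Y f YS [finj fopen].
have fc : continuous f by apply/continuousP => V Vo; apply/fopen; exists V.
move=> y cly; apply: contrapT => ny.
pose gamma := [set U : set X | open U /\ ~ closure (f @` U) y].
have [|D [Df Dg DT]] := cov gamma.
  apply/S_coverP; split=> [U []//|x _].
  have /theta_separatedP[V Vchain Vy] : ~ theta_closure n.+1 [set y] (f x).
    by apply: YS => fxy; apply: ny; exists x.
  have fV := theta_chain_preimage fc Vchain.
  exists (f @^-1` V n.+1); last by exists (fun i => f @^-1` V i).
  split; first exact: (fV.1 n.+1 (leqnn _)).1.
  by apply: contra_not Vy; apply: closureS; exact: image_preimage_subset.
pose C := \bigcup_(U in D) closure (f @` U).
have Cc : closed C by apply: closed_bigcup => // U _; exact: closed_closure.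
have fC : setT `<=` f @^-1` C.
  rewrite -DT closureE; apply: smallest_sub.
    by move/continuous_closedP: fc; apply.
  by move=> x [U DU Ux]; exists U => //; apply: subset_closure; exists x.
have [U /Dg[_ nU] /nU//] : C y.
by apply: Cc; apply: closureS cly => _ [x _ <-]; exact: fC.
Qed.

(** * Weak convergence of infinite sets *)

Lemma S_closed_weakly_theta_converges (X : topologicalType) (n : nat)
    (A : set X) : S_closed n.+1 X -> infinite_set A ->
  weakly_theta_converges n.+1 A (complete_accumulation_points n.+1 A).
Proof.
move=> Xclosed Ainf gamma /S_coverP[go gB].
pose small := [set V : set X | open V /\ card_lt (A `&` closure V) A].
have [|D [Dfin Dsub Ddense]] := S_closed_cover (gamma := gamma `|` small) Xclosed.
  apply/S_coverP; split=> [U [/go//|[]//]|x _].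
  have [/gB[U gU Ux]|nBx] := pselect (complete_accumulation_points n.+1 A x).
    by exists U => //; left.
  have [V Vx AV] : exists2 V, is_hull n.+1 x V & ~ ((A `&` closure V) #= A).
    apply: contrapT => nV; apply: nBx => V Vx.
    by apply: contrapT => AV; apply: nV; exists V.
  exists V => //; right; split.
    by case: Vx => U [[Un _] <-]; exact: (Un n.+1 (leqnn _)).1.
  by split=> //; apply: subset_card_le; exact: subIsetl.
exists (D `&` gamma); split; [exact: finite_setIl|exact: subIsetr|].
apply: (@card_le_lt_trans _ _ _ _ (\bigcup_(V in D `&` small) (A `&` closure V))).
  2: by apply: card_lt_bigcup => // [|V [_ []]//]; exact: finite_setIl.
apply: subset_card_le => a [Aa na]; rewrite -setI_bigcupr; split=> //.
rewrite -closure_bigcup_finite; last exact: finite_setIl.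
(* Otherwise [a] has a neighborhood missing the small members; by density it lies in the closure of
   the union of the members from [gamma], so [a] is interior there. *)
apply: contrapT => nsmall; apply: na.
apply: (@filterS _ (nbhs a) _ (~` closure (\bigcup_(V in D `&` small) V))).
  move=> x nsmallx; rewrite -closure_bigcup_finite; last exact: finite_setIl.
  have : closure (\bigcup_(U in D) U) x by rewrite Ddense.
  rewrite -{1}(setIidl Dsub) setIUr.
  by rewrite bigcup_setU closureU => -[|/nsmallx].
by apply: open_nbhs_nbhs; split=> //; apply: closed_openC; exact: closed_closure.
Qed.

Lemma weakly_theta_converges_cover (X : topologicalType) (n : nat)
    (gamma : set (set X)) :
  (forall A : set X, infinite_set A ->
    weakly_theta_converges n.+1 A (complete_accumulation_points n.+1 A)) ->
  S_cover n setT gamma ->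
  exists D : set (set X),
    [/\ finite_set D, D `<=` gamma & closure (\bigcup_(U in D) U) = setT].
Proof.
move=> Xconv gcover; apply: contrapT => nD.
pose subfamily := {D : set (set X) | finite_set D /\ D `<=` gamma}.
pose F (D : subfamily) : set X := ~` closure (\bigcup_(U in sval D) U).
have [[D0 [D0fin D0sub]] D0min] := card_le_min
  (exist _ set0 (conj (finite_set0 _) (@sub0set _ _)) : subfamily) F.
pose A := ~` closure (\bigcup_(U in D0) U).
have Amin D : finite_set D -> D `<=` gamma ->
    A #<= A `\` closure (\bigcup_(U in D) U).
  move=> Dfin Dsub.
  have DD0 : finite_set (D0 `|` D) /\ D0 `|` D `<=` gamma.
    by rewrite finite_setU; split=> // U [/D0sub|/Dsub].
  (* The set [F] assigns to the union of [D0] and [D] is [A] minus the closure of the union of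
     [D]. *)
  have := D0min (exist _ _ DD0).
  by rewrite /F /= bigcup_setU closureU setCU.
have [a Aa] : A !=set0.
  apply/set0P/eqP => A0; apply: nD; exists D0; split=> //.
  by apply: setC_inj; rewrite setCT.
(* Removing the closure of a member of the cover around [a] drops [a] but leaves a set at least as
   large as [A]. *)
have Ainf : infinite_set A.
  have [_ /(_ a I)[U gU [W [[Wn _] WU]]]] := (S_coverP _ _ _).1 gcover.
  have Ua : U a by rewrite -WU; exact: (Wn n.+1 (leqnn _)).2.
  apply: (card_le_setD1_infinite Aa); apply: card_le_trans (Amin [set U] _ _) _.
  - exact: finite_set1.
  - by move=> _ ->.
  - apply: subset_card_le => x [Ax nUx]; split=> // xa; apply: nUx.
    by rewrite xa bigcup_set1; exact: subset_closure.
have gB : S_cover n (complete_accumulation_points n.+1 A) gamma.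
  by case: gcover => go gT; split=> // x _; exact: gT.
have [D [Dfin Dsub [DleA]]] := Xconv A Ainf gamma gB; apply.
(* The interior of the union of closures lies in the closure of the union, so by [Amin] the rest of
   [A] is as large as [A]. *)
apply: Cantor_Bernstein => //; apply: card_le_trans (Amin D Dfin Dsub) _.
apply: subset_card_le => x [Ax nx]; split=> //; apply: contra_not nx.
by rewrite closure_bigcup_finite //; exact: interior_subset.
Qed.

Theorem theorem4p3 (n : nat) (X : topologicalType) (hn : (1 <= n)%N)
    (hX : S_space n X) :
  S_closed n X <->
  (forall A : set X, infinite_set A ->
     weakly_theta_converges n A (complete_accumulation_points n A)).
Proof.
case: n hn hX => // n _ hX; split=> [Xclosed A|Xconv].
  exact: S_closed_weakly_theta_converges.
by apply: cover_S_closed => // gamma; exact: weakly_theta_converges_cover.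
Qed.
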